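(* Let $G\sim\mathbb{G}(n,1/2)$. With high probability as $n\to\infty$, $G$ admits a bisection in which $n-o(n)$ vertices are friendly. That is, for every $\delta>0$, the probability that there exists a bisection $A\cup B$ of the vertex set of $G$ in which at least $(1-\delta)n$ vertices are friendly tends to $1$ as $n\to\infty$.
   Context: $\mathbb{G}(n,1/2)$ is the Erdős–Rényi random graph on $n$ labelled vertices in which each pair of vertices is an edge independently with probability $1/2$. A bisection of a graph is a partition of its vertex set into two parts $A\cup B$ whose sizes differ by at most one. Given such a partition, a vertex is friendly if it has strictly more neighbours in its own part than in the other part, and unfriendly otherwise. *)

(* Defs.v *)
From HB Require Import structures.
From mathcomp Require Import all_boot all_order all_algebra.
From mathcomp Require Import all_classical all_reals all_analysis.

Set Implicit Arguments.
Unset Strict Implicit.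
Unset Printing Implicit Defensive.
Import Order.TTheory GRing.Theory Num.Theory.
Import numFieldNormedType.Exports.
Local Open Scope ring_scope.

(* A graph on the vertex set 'I_n is given by its edge set, a set of unordered
   pairs of distinct vertices. *)
Definition vpairs (n : nat) : {set {set 'I_n}} :=
  [set e : {set 'I_n} | #|e| == 2%N].

Definition is_graph (n : nat) (G : {set {set 'I_n}}) : bool := G \subset vpairs n.

Definition neighbours (n : nat) (G : {set {set 'I_n}}) (v : 'I_n) : {set 'I_n} :=
  [set w | [set v; w] \in G].

(* The partition of the vertex set is into A and its complement. *)
Definition bisection (n : nat) (A : {set 'I_n}) : bool :=
  (#|A| <= #|~: A| + 1)%N && (#|~: A| <= #|A| + 1)%N.

Definition own_part (n : nat) (A : {set 'I_n}) (v : 'I_n) : {set 'I_n} :=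
  if v \in A then A else ~: A.

Definition friendly (n : nat) (G : {set {set 'I_n}}) (A : {set 'I_n})
    (v : 'I_n) : bool :=
  (#|neighbours G v :&: ~: own_part A v| < #|neighbours G v :&: own_part A v|)%N.

Definition friendly_vertices (n : nat) (G : {set {set 'I_n}}) (A : {set 'I_n}) :
    {set 'I_n} :=
  [set v | friendly G A v].

(* The law of G(n,p): independence of the edges makes the mass of a graph the
   product, over all pairs, of p for an edge and 1 - p for a non-edge. *)
Definition Gnp_mass (R : realType) (n : nat) (p : R) (G : {set {set 'I_n}}) : R :=
  \prod_(e in vpairs n) (if e \in G then p else 1 - p).

Definition Gnp_prob (R : realType) (n : nat) (p : R)
    (E : pred {set {set 'I_n}}) : R :=
  \sum_(G : {set {set 'I_n}} | is_graph G && E G) Gnp_mass p G.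

(* Every set S of k pairs is contained in the random graph with probability
   p ^+ k: the edge events are independent of probability p, and (S empty) the
   total mass is 1. *)
Lemma Gnp_prob_sub (R : realType) (n : nat) (p : R) (S : {set {set 'I_n}}) :
  S \subset vpairs n ->
  Gnp_prob p (fun G : {set {set 'I_n}} => S \subset G) = p ^+ #|S|.
Proof.
move=> sSP.
pose f (e : {set 'I_n}) : R := if e \in vpairs n then p else 0.
pose g (e : {set 'I_n}) : R :=
  if e \in vpairs n then (if e \in S then 0 else 1 - p) else 1.
have -> : p ^+ #|S| = \prod_e (f e + g e).
  rewrite -prodr_const [RHS](bigID (mem S)) /= [X in _ * X]big1 ?mulr1.
    by apply: eq_bigr => e eS; rewrite /f /g (fintype.subsetP sSP _ eS) eS addr0.
  move=> e /negbTE eS; rewrite /f /g eS.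
  by case: ifP => _; rewrite ?add0r // addrC subrK.
rewrite bigA_distr /= /Gnp_prob big_mkcond /=; apply: eq_bigr => G _.
case: ifP => [/andP[Ggr SG]|].
  rewrite /Gnp_mass big_mkcond; apply: eq_bigr => e _; rewrite /f /g.
  case: (boolP (e \in G)) => eG; case: ifP => eP //.
    by move: eP; rewrite (fintype.subsetP Ggr _ eG).
  by case: ifP => // /(fintype.subsetP SG); rewrite (negbTE eG).
move/negbT; rewrite negb_and => /orP[] /fintype.subsetPn[e e1 e2].
  by rewrite (bigD1 e) //= e1 /f (negbTE e2) mul0r.
by rewrite (bigD1 e) //= (negbTE e2) /g e1 (fintype.subsetP sSP _ e1) mul0r.
Qed.

(* Main.v *)
(* Seidel switching. For a vertex set A, switching G at A complements the pairs
   between A and its complement; a vertex is friendly for a bisection A as soon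
   as its degree in the switched graph exceeds the size of the other part.

   Choosing A so that the switched graph has the most edges makes every degree
   at least (n-1)/2 there. Switching at a uniformly random set B preserves the
   law of the graph and replaces an optimal A by the symmetric difference of A
   and B, so by Chebyshev some optimal A is, with high probability, within o(n)
   of a bisection; flipping a set T of o(n) vertices makes it one. Two union
   bounds, over all A (and over all A and T), show that this leaves most
   vertices friendly. In the switched graph only few degrees are within
   O(sqrt n) of (n-1)/2, and flipping T moves only few of the other degrees by
   that much: for a fixed set S of vertices the edges from distinct vertices of
   S to a set disjoint from S are independent, so the probability that all of S
   is exceptional is at most K^-|S| with K as large as we like, which beats the
   8^n choices once |S| is a constant fraction of n. *)

Require Import Defs.
From HB Require Import structures.
From mathcomp Require Import all_boot all_order all_algebra.
From mathcomp Require Import all_classical all_reals all_analysis.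
From mathcomp Require Import zify ring lra.

Set Implicit Arguments.
Unset Strict Implicit.
Unset Printing Implicit Defensive.
Import Order.TTheory GRing.Theory Num.Theory.
Import numFieldNormedType.Exports.

(** * Symmetric difference, averaging and union bounds *)

Definition symd (T : finType) (A B : {set T}) : {set T} :=
  [set x | (x \in A) (+) (x \in B)].

Lemma symdK (T : finType) (B : {set T}) : involutive (fun A => symd A B).
Proof. by move=> A; apply/setP=> x; rewrite !inE -addbA addbb addbF. Qed.

Lemma symdKl (T : finType) (A : {set T}) : involutive (symd A).
Proof. by move=> B; apply/setP=> x; rewrite !inE addbA addbb addFb. Qed.

Lemma symd_sub (T : finType) (A B U : {set T}) :
  A \subset U -> B \subset U -> symd A B \subset U.
Proof.
move=> /fintype.subsetP sA /fintype.subsetP sB.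
apply/fintype.subsetP=> x; rewrite inE.
by have := sA x; have := sB x; case: (x \in A); case: (x \in B) => //= H1 H2 _; auto.
Qed.

(** Toggling inside [U] leaves [A :\: U] fixed. A degree after resampling is thus a constant plus
    the size of a random subset of [U]. *)
Lemma card_symd_split (T : finType) (A B U : {set T}) : B \subset U ->
  #|symd A B| = #|A :\: U| + #|symd (A :&: U) B|.
Proof.
move=> /fintype.subsetP sB; rewrite -(cardsID U (symd A B)) addnC; congr (_ + _).
  apply: eq_card => x; rewrite !inE; have := sB x.
  by case: (x \in U); case: (x \in B); case: (x \in A) => //= H; have := H isT.
apply: eq_card => x; rewrite !inE; have := sB x.
by case: (x \in U); case: (x \in B); case: (x \in A) => //= H; have := H isT.
Qed.

(* Double counting of pairs (x, y): the fibre {phi y x} of every x is hit by P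
   with frequency at most 1 / K. *)
Lemma card_average (X Y : finType) (phi : Y -> X -> X) (I : {set Y})
    (Q P : pred X) (K : nat) :
  (forall y, y \in I -> involutive (phi y)) ->
  (forall x y, y \in I -> Q (phi y x) = Q x) ->
  (forall x, Q x -> #|[set y in I | P (phi y x)]| * K <= #|I|) ->
  0 < #|I| ->
  #|[set x | Q x && P x]| * K <= #|[set x | Q x]|.
Proof.
move=> phiK phiQ avg I0; rewrite -(leq_pmul2l I0).
have -> : #|I| * (#|[set x | Q x && P x]| * K)
    = \sum_(x | Q x) #|[set y in I | P (phi y x)]| * K.
  rewrite mulnA -big_distrl /=; congr (_ * _).
  rewrite -sum_nat_const.
  transitivity (\sum_(y in I) \sum_(x | Q x && P (phi y x)) 1).
    apply: eq_bigr => y yI.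
    have -> : [set x | Q x && P x] = [set phi y x | x in [set x | Q x && P (phi y x)]].
      apply/setP=> x; rewrite inE; apply/idP/imsetP.
        move=> h; exists (phi y x); last by rewrite phiK.
        by rewrite inE phiQ // phiK.
      by case=> z; rewrite inE => h ->; rewrite phiQ.
    rewrite card_imset; last exact: can_inj (phiK y yI).
    by rewrite -sum1_card; apply: eq_bigl => x; rewrite inE.
  rewrite (exchange_big_dep Q) /=; last by move=> y x _ /andP[].
  apply: eq_bigr => x Qx; rewrite -sum1_card; apply: eq_bigl => y.
  by rewrite inE Qx.
rewrite mulnC -sum_nat_const big_mkcond /= [leqRHS]big_mkcond /=.
by apply: leq_sum => x _; rewrite inE; case: ifP => // /avg.
Qed.

Lemma card_union_bound (X Y : finType) (P : Y -> pred X) (K N : nat) :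
  (forall y, #|[set x | P y x]| * K <= N) ->
  #|[set x | [exists y, P y x]]| * K <= #|Y| * N.
Proof.
move=> H.
have h : #|[set x | [exists y, P y x]]| <= \sum_y #|[set x | P y x]|.
  have -> : [set x | [exists y, P y x]] = \bigcup_y [set x | P y x].
    apply/setP=> x; rewrite inE; apply/existsP/bigcupP => [[y h]|[y _ h]].
      by exists y; rewrite ?inE.
    by exists y; rewrite inE in h.
  elim/big_rec2: _ => [|y n A _ IH]; first by rewrite cards0.
  by rewrite (leq_trans (leq_card_setU _ _).1) // leq_add2l.
rewrite (leq_trans (leq_mul h (leqnn K))) // big_distrl /= -sum_nat_const.
exact: leq_sum.
Qed.

(** * The size of a uniformly random subset: second moment and largest point mass *)

Lemma card_subsets_by_card (T : finType) (U : {set T}) (P : pred nat) :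
  #|[set Y : {set T} | (Y \subset U) && P #|Y|]|
  = \sum_(k < #|U|.+1 | P k) 'C(#|U|, k).
Proof.
rewrite -sum1_card (partition_big (fun Y : {set T} => inord #|Y| : 'I_#|U|.+1) P) /=.
  apply: eq_bigr => k Pk; rewrite -cards_draws -[RHS]sum1_card.
  apply: eq_bigl => Y; rewrite !inE; apply/idP/idP.
    move=> /andP[/andP[sY PY] /eqP <-]; rewrite sY inordK ?eqxx //.
    by rewrite ltnS subset_leq_card.
  move=> /andP[sY /eqP cY]; rewrite sY cY Pk /=; apply/eqP/val_inj.
  by rewrite /= inordK.
by move=> Y; rewrite inE => /andP[sY PY]; rewrite inordK // ltnS subset_leq_card.
Qed.

(** A uniform subset of [U] stays uniform under translation by a fixed [Z], because [symd Z]
    permutes the subsets of [U]. *)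
Lemma card_subsets_shift (T : finType) (U Z : {set T}) (P : pred {set T}) :
  Z \subset U ->
  #|[set Y : {set T} | (Y \subset U) && P (symd Z Y)]|
  = #|[set Y : {set T} | (Y \subset U) && P Y]|.
Proof.
move=> sZ; rewrite -(card_imset _ (can_inj (symdKl Z))).
apply: eq_card => Y; rewrite [RHS]inE; apply/imsetP/idP.
  by case=> W; rewrite inE => /andP[sW PW] ->; rewrite PW symd_sub.
move=> /andP[sY PY]; exists (symd Z Y); last by rewrite symdKl.
by rewrite inE symdKl PY symd_sub.
Qed.

(* The shift [a] is what makes Pascal's rule close the induction on [m]. *)
Lemma sum_bin_variance (m : nat) (a : int) :
  (\sum_(k < m.+1) ('C(m, k))%:Z * (k%:Z * 2 - m%:Z + a) ^+ 2
   = 2 ^+ m * (m%:Z + a ^+ 2))%R.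
Proof.
elim: m a => [|m IH] a.
  by rewrite big_ord1 /= bin0; lia.
rewrite big_ord_recl /= bin0.
under eq_bigr => k _ do rewrite /bump /= binS PoszD mulrDl.
rewrite big_split /= addrA.
have -> : (1%:Z * (0%:Z * 2 - m.+1%:Z + a) ^+ 2 +
   \sum_(i < m.+1) 'C(m, i.+1)%:Z * (i.+1%:Z * 2 - m.+1%:Z + a) ^+ 2)%R
  = (\sum_(k < m.+1) 'C(m, k)%:Z * (k%:Z * 2 - m%:Z + (a - 1)) ^+ 2)%R.
  rewrite big_ord_recr /= bin_small // (mul0r (_ ^+ 2)%R) addr0.
  rewrite [RHS]big_ord_recl /= bin0; congr (_ * _ ^+ 2 + _)%R; first by lia.
  by apply: eq_bigr => i _; rewrite /bump /=; congr (_ * _ ^+ 2)%R; lia.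
have -> : (\sum_(i < m.+1) 'C(m, i)%:Z * ((1 + i)%N%:Z * 2 - m.+1%:Z + a) ^+ 2
  = \sum_(k < m.+1) 'C(m, k)%:Z * (k%:Z * 2 - m%:Z + (a + 1)) ^+ 2)%R.
  by apply: eq_bigr => i _; congr (_ * _ ^+ 2)%R; lia.
rewrite !IH [(2 ^+ m.+1)%R]exprS; have -> : (m.+1%:Z = m%:Z + 1)%R by lia.
ring.
Qed.

(** Chebyshev's inequality: for uniform [Y] inside [U], the second moment of $2|Y|-|U|$ is $|U|$,
    which is [sum_bin_variance] with shift 0. *)
Lemma card_subsets_deviation (T : finType) (U : {set T}) (P : pred nat) (l : nat) :
  (forall k, P k -> (l%:Z ^+ 2 <= (k%:Z * 2 - #|U|%:Z) ^+ 2)%R) ->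
  #|[set Y : {set T} | (Y \subset U) && P #|Y|]| * l ^ 2 <= #|U| * 2 ^ #|U|.
Proof.
move=> H; rewrite card_subsets_by_card.
have := sum_bin_variance #|U| 0; rewrite expr0n /= addr0 => E.
rewrite -lez_nat; have -> : Posz (#|U| * 2 ^ #|U|) = (2 ^+ #|U| * #|U|%:Z)%R.
  by rewrite -!natz natrM natrX mulrC.
rewrite -E PoszM -[X in (X * _)%R]natz natr_sum big_distrl /= big_mkcond /=.
apply: ler_sum => k _; rewrite addr0; case: ifP => Pk.
  by rewrite natz ler_wpM2l // (le_trans _ (H _ Pk)).
by rewrite mulr_ge0 // sqr_ge0.
Qed.

Lemma bin_le_central m k : 'C(m.*2, k) <= 'C(m.*2, m).
Proof.
have up j : j < m -> 'C(m.*2, j) <= 'C(m.*2, j.+1).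
  by move=> jm; have := mul_bin_left m.*2 j; nia.
have low j i : j + i = m -> 'C(m.*2, j) <= 'C(m.*2, m).
  elim: i j => [|i IH] j; first by rewrite addn0 => ->.
  by move=> h; apply: leq_trans (up _ _) (IH _ _); lia.
case: (leqP k m) => km; first by apply: (low k (m - k)); lia.
case: (leqP k m.*2) => km2; last by rewrite bin_small.
by rewrite -bin_sub //; apply: (low _ (k - m)); lia.
Qed.

Lemma central_bin_sqr m : 'C(m.*2, m) ^ 2 * m.*2.+1 <= 4 ^ m.*2.
Proof.
elim: m => [|m IH] //.
(* The ratio of consecutive central coefficients; the induction then reduces to $(2m+3)(2m+1) \le
   (2m+2)^2$. *)
have E : m.+1 * 'C(m.+1.*2, m.+1) = 2 * m.*2.+1 * 'C(m.*2, m).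
  have e1 := mul_bin_diag m.+1.*2 m; rewrite doubleS /= in e1.
  have e2 := mul_bin_diag m.*2.+1 m; rewrite /= in e2.
  have e3 := binS m.*2.+1 m.
  have e4 := bin_sub (n := m.*2.+1) (m := m).
  have e5 : m.*2.+1 - m = m.+1 by lia.
  rewrite e5 in e4; have {}e4 := e4 _; rewrite doubleS e3.
  have e6 := e4 ltac:(lia); nia.
have -> : 4 ^ m.+1.*2 = 16 * 4 ^ m.*2 by rewrite doubleS !expnS; lia.
rewrite -(@leq_pmul2l (m.+1 ^ 2)) // mulnA -expnMn E.
have : m.+1.*2.+1 * m.*2.+1 <= 4 * m.+1 ^ 2 by rewrite doubleS; nia.
move: IH; set C := 'C(_, _); set X := 4 ^ _ => IH h.
have -> : (2 * m.*2.+1 * C) ^ 2 * m.+1.*2.+1 = 4 * ((C ^ 2 * m.*2.+1) * (m.+1.*2.+1 * m.*2.+1)) by ring.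
have -> : m.+1 ^ 2 * (16 * X) = 4 * (X * (4 * m.+1 ^ 2)) by ring.
by rewrite leq_pmul2l // leq_mul.
Qed.

(** No size of a random subset of an [m]-set has probability above $m^{-1/2}$. In an odd row,
    Pascal's rule bounds each entry by twice the central coefficient of the row before. *)
Lemma bin_sqr_le m k : 'C(m, k) ^ 2 * m <= 4 ^ m.
Proof.
rewrite -(odd_double_half m); case: (odd m); set h := m./2; rewrite ?add0n ?add1n.
  have c := bin_le_central h.
  have hk : 'C(h.*2.+1, k) <= 2 * 'C(h.*2, h).
    rewrite mul2n -[_.*2 in leqRHS]addnn; case: k => [|k]; last exact: leq_add.
    by have := c 0; rewrite !bin0; lia.
  rewrite [leqRHS]expnS; apply: leq_trans (leq_mul (leqnn 4) (central_bin_sqr h)).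
  by rewrite mulnA leq_mul2r (leq_trans (_ : _ <= (2 * 'C(h.*2, h)) ^ 2)) ?leq_sqr ?expnMn ?orbT.
apply: leq_trans (central_bin_sqr h); rewrite leq_mul ?leq_sqr //.
exact: bin_le_central.
Qed.

(** * Switching at a cut and toggling a star at one vertex *)

Definition cut (n : nat) (A : {set 'I_n}) : {set {set 'I_n}} :=
  [set [set v; w] | v in A, w in ~: A].

Definition switch (n : nat) (A : {set 'I_n}) (G : {set {set 'I_n}}) :
  {set {set 'I_n}} := symd G (cut A).

Definition star (n : nat) (v : 'I_n) (Y : {set 'I_n}) : {set {set 'I_n}} :=
  [set [set v; w] | w in Y].

Lemma eq_pair_set (T : finType) (a b c d : T) :
  [set a; b] = [set c; d] -> (a = c /\ b = d) \/ (a = d /\ b = c).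
Proof.
move=> E.
have: a \in [set c; d] by rewrite -E !inE eqxx.
have: b \in [set c; d] by rewrite -E !inE eqxx orbT.
have: c \in [set a; b] by rewrite E !inE eqxx.
have: d \in [set a; b] by rewrite E !inE eqxx orbT.
rewrite !inE.
by move=> /orP[]/eqP ? /orP[]/eqP ? /orP[]/eqP ? /orP[]/eqP ?; subst; auto.
Qed.

Lemma in_cut (n : nat) (A : {set 'I_n}) v w :
  ([set v; w] \in cut A) = (v \in A) (+) (w \in A).
Proof.
apply/imset2P/idP => [[a b aA]|].
  rewrite inE => bA /eq_pair_set [] [-> ->]; by rewrite aA (negbTE bA).
case: (boolP (v \in A)) => vA wA.
  by exists v w; rewrite // inE.
by exists w v; rewrite ?inE // finset.setUC.
Qed.

Lemma in_star (n : nat) (v w : 'I_n) Y : ([set v; w] \in star v Y) = (w \in Y).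
Proof.
apply/imsetP/idP => [[u uY /eq_pair_set [] [? ?]]|wY]; subst => //.
by exists w.
Qed.

Lemma notin_star (n : nat) (u v w : 'I_n) (Y : {set 'I_n}) :
  u != v -> u \notin Y -> [set u; w] \notin star v Y.
Proof.
move=> uv uY; apply/imsetP=> -[x xY /eq_pair_set [] [E _]].
  by rewrite E eqxx in uv.
by rewrite E xY in uY.
Qed.

Lemma cut_sub_vpairs (n : nat) (A : {set 'I_n}) : cut A \subset vpairs n.
Proof.
apply/fintype.subsetP => e /imset2P[v w vA]; rewrite inE => wA ->.
by rewrite inE cards2; case: (eqVneq v w) vA => // ->; rewrite (negbTE wA).
Qed.

Lemma star_sub_vpairs (n : nat) (v : 'I_n) (Y : {set 'I_n}) :
  v \notin Y -> star v Y \subset vpairs n.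
Proof.
move=> vY; apply/fintype.subsetP => e /imsetP[w wY ->].
by rewrite inE cards2; case: (eqVneq v w) vY => // ->; rewrite wY.
Qed.

Lemma is_graph_symd (n : nat) (G H : {set {set 'I_n}}) :
  H \subset vpairs n -> is_graph (symd G H) = is_graph G.
Proof.
move=> sH; apply/idP/idP => gG; last exact: symd_sub.
by rewrite /is_graph -(symdK H G) symd_sub.
Qed.

Lemma neighbours_switch (n : nat) (A : {set 'I_n}) G v :
  neighbours (switch A G) v
  = [set w | (w \in neighbours G v) (+) ((v \in A) (+) (w \in A))].
Proof. by apply/setP => w; rewrite !inE in_cut. Qed.

Lemma neighbours_star (n : nat) (v : 'I_n) Y G :
  neighbours (symd G (star v Y)) v = symd (neighbours G v) Y.
Proof. by apply/setP => w; rewrite !inE in_star. Qed.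

Lemma neighbours_star_other (n : nat) (u v : 'I_n) (Y : {set 'I_n}) G :
  u != v -> u \notin Y -> neighbours (symd G (star v Y)) u = neighbours G u.
Proof.
move=> uv uY; apply/setP => w.
by rewrite !inE (negbTE (notin_star w uv uY)) addbF.
Qed.

Lemma neighbours_irr (n : nat) (G : {set {set 'I_n}}) v :
  is_graph G -> v \notin neighbours G v.
Proof.
move=> /fintype.subsetP gG; rewrite inE; apply/negP => /gG.
by rewrite inE finset.setUid cards1.
Qed.

(** * Counting graphs: invariance under switching and independent rows *)

Lemma card_graphs (n : nat) :
  #|[set G : {set {set 'I_n}} | is_graph G]| = 2 ^ #|vpairs n|.
Proof. by rewrite -card_powerset; apply: eq_card => G; rewrite !inE. Qed.

Lemma switchK (n : nat) (A : {set 'I_n}) : involutive (switch A).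
Proof. exact: symdK. Qed.

Lemma is_graph_switch (n : nat) (A : {set 'I_n}) G :
  is_graph (switch A G) = is_graph G.
Proof. exact: is_graph_symd (cut_sub_vpairs A). Qed.

Lemma card_graphs_switch (n : nat) (A : {set 'I_n}) (P : pred {set {set 'I_n}}) :
  #|[set G | is_graph G && P (switch A G)]| = #|[set G | is_graph G && P G]|.
Proof.
rewrite -(card_imset _ (can_inj (switchK A))).
apply: eq_card => G; rewrite [RHS]inE; apply/imsetP/idP.
  by case=> H; rewrite inE => /andP[gH PH] ->; rewrite is_graph_switch gH.
move=> /andP[gG PG]; exists (switch A G); last by rewrite switchK.
by rewrite inE switchK is_graph_switch gG.
Qed.

(* Resampling the pairs between [i] and [U] affects only the event of row [i],
   so each row of [S] costs an independent factor [K]. *)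
Lemma card_graphs_rows (n : nat) (S U : {set 'I_n})
    (P : 'I_n -> pred {set {set 'I_n}}) (K : nat) :
  [disjoint S & U] ->
  (forall i j (Y : {set 'I_n}) G, i \in S -> j \in S -> j != i -> Y \subset U ->
     P j (symd G (star i Y)) = P j G) ->
  (forall i G, i \in S ->
     #|[set Y : {set 'I_n} | (Y \subset U) && P i (symd G (star i Y))]| * K
     <= 2 ^ #|U|) ->
  #|[set G : {set {set 'I_n}} | is_graph G && [forall i in S, P i G]]| * K ^ #|S|
  <= 2 ^ #|vpairs n|.
Proof.
move=> dSU indep avg.
(* Rows are peeled off one at a time along a duplicate-free list of the elements of [S]. *)
suff H (s : seq 'I_n) : uniq s -> {subset s <= S} ->
    #|[set G : {set {set 'I_n}} | is_graph G && all (P^~ G) s]| * K ^ size s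
    <= 2 ^ #|vpairs n|.
  have := H (enum S) (enum_uniq _) (fun x => _ : x \in enum S -> x \in S).
  rewrite -cardE => /(_ (fun x => ltac:(by rewrite mem_enum))) H'.
  apply: leq_trans H'; rewrite leq_mul2r; apply/orP; right.
  apply: subset_leq_card; apply/fintype.subsetP => G; rewrite !inE.
  move=> /andP[-> /forall_inP h] /=; apply/allP => i; rewrite mem_enum; exact: h.
elim: s => [|i s IH] /=.
  move=> _ _; rewrite muln1 -card_graphs.
  by apply: subset_leq_card; apply/fintype.subsetP => G; rewrite !inE andbT.
move=> /andP[iNs us] sS.
have iS : i \in S by apply: sS; rewrite inE eqxx.
have {}sS : {subset s <= S} by move=> x xs; apply: sS; rewrite inE xs orbT.
apply: leq_trans (IH us sS); rewrite expnS mulnA leq_mul2r; apply/orP; right.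
have iNU (Y : {set 'I_n}) : Y \subset U -> i \notin Y.
  move=> /fintype.subsetP sY; apply/negP => /sY iU.
  by move/pred0P: dSU => /(_ i) /=; rewrite iS iU.
have -> : [set G | is_graph G && (P i G && all (P^~ G) s)]
    = [set G | is_graph G && all (P^~ G) s && P i G].
  by apply/setP => G; rewrite !inE andbA andbAC.
(* Averaging over the pairs from [i] to [U], with [Q] the event of the remaining rows, which these
   pairs do not affect. *)
apply: (@card_average _ _ (fun Y G => symd G (star i Y)) (powerset U)).
- by move=> Y _; apply: symdK.
- move=> G Y; rewrite inE => sY.
  rewrite is_graph_symd ?star_sub_vpairs ?iNU //; congr (_ && _).
  apply: eq_in_all => j js; apply: indep => //; first exact: sS.
  by apply: contraNneq iNs => <-.
- move=> G _; rewrite card_powerset.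
  suff <- : #|[set Y : {set 'I_n} | (Y \subset U) && P i (symd G (star i Y))]| =
    #|[set Y in powerset U | P i (symd G (star i Y))]| by exact: avg.
  by apply: eq_card => Y; rewrite !inE.
- by rewrite card_powerset expn_gt0.
Qed.

(** * Exceptional vertices: degrees barely above the middle, and losses caused by a flip *)

Lemma exists_subset_card (T : finType) (A : {set T}) s :
  s <= #|A| -> exists2 B : {set T}, B \subset A & #|B| = s.
Proof.
rewrite -bin_gt0 -cards_draws => /card_gt0P[B]; rewrite inE => /andP[sB /eqP cB].
by exists B.
Qed.

Lemma card_sets_ord (n : nat) : #|{: {set 'I_n}}| = 2 ^ n.
Proof. by rewrite -cardsT -powersetT card_powerset cardsT card_ord. Qed.

(** If [F G] has at least [s] elements, it contains a set of exactly [s]; the factor [2 ^ n] pays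
    for the choice of that set. *)
Lemma card_graphs_many_rows (n : nat) (F : {set {set 'I_n}} -> {set 'I_n})
    (s N K : nat) :
  (forall S : {set 'I_n}, #|S| = s ->
     #|[set G | is_graph G && (S \subset F G)]| * K <= N) ->
  #|[set G | is_graph G && (s <= #|F G|)]| * K <= 2 ^ n * N.
Proof.
move=> H.
have := @card_union_bound _ {set 'I_n}
  (fun S G => [&& #|S| == s, is_graph G & S \subset F G]) K N.
rewrite card_sets_ord => /(_ _)/(leq_trans _); apply; first last.
  move=> S; case: (eqVneq #|S| s) => [/H //|_] /=.
  by rewrite (_ : [set _ | _] = finset.set0) ?cards0 //; apply/setP => G; rewrite !inE.
rewrite leq_mul2r; apply/orP; right.
apply: subset_leq_card; apply/fintype.subsetP => G; rewrite !inE.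
move=> /andP[gG /exists_subset_card[S sS cS]].
by apply/existsP; exists S; rewrite cS eqxx gG.
Qed.

(** The window is $(n-1)/2 \le \deg \le (n-1+r)/2$, whose lower end is the degree guaranteed by
    local optimality. *)
Definition barely_large (n r : nat) (G : {set {set 'I_n}}) : {set 'I_n} :=
  [set i | n <= (#|neighbours G i|.*2).+1 <= n + r].

Lemma card_window (m c n r : nat) :
  #|[pred k : 'I_m | n <= ((c + k).*2).+1 <= n + r]| <= r.+1.
Proof.
rewrite -[r.+1]card_ord.
apply: (@leq_card_in _ _ (fun k : 'I_m => inord (((c + k).*2).+1 - n) : 'I_r.+1)).
move=> i j; rewrite !inE => hi hj /(congr1 val) /=.
rewrite !inordK; try lia.
by move=> E; apply/val_inj => /=; lia.
Qed.

(** Resampling makes the degree of [i] a constant plus the size of a uniform subset of [U]. At most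
    [r.+1] sizes fall in the window, each of probability at most $|U|^{-1/2} \le 1/(K(r+1))$. *)
Lemma card_barely_large_row (n r K : nat) (U : {set 'I_n}) i G :
  (K * r.+1) ^ 2 <= #|U| ->
  #|[set Y : {set 'I_n} | (Y \subset U)
      && (i \in barely_large r (symd G (star i Y)))]| * K <= 2 ^ #|U|.
Proof.
move=> hK; set N := neighbours G i; set c := #|N :\: U|.
pose P k := n <= ((c + k).*2).+1 <= n + r.
have -> : [set Y : {set 'I_n} | (Y \subset U)
      && (i \in barely_large r (symd G (star i Y)))]
  = [set Y : {set 'I_n} | (Y \subset U) && P #|symd (N :&: U) Y|].
  apply/setP => Y; rewrite !inE; case: (boolP (Y \subset U)) => //= sY.
  by rewrite neighbours_star (card_symd_split _ sY).
rewrite (card_subsets_shift (fun Y => P #|Y|)) ?finset.subsetIr //.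
rewrite card_subsets_by_card -(leq_pmul2r (ltn0Sn r)) -mulnA big_distrl /=.
apply: (@leq_trans (\sum_(k < #|U|.+1 | P k) 2 ^ #|U|)).
  apply: leq_sum => k _; rewrite -leq_sqr expnMn.
  have -> : (2 ^ #|U|) ^ 2 = 4 ^ #|U| by rewrite -expnM mulnC expnM.
  exact: leq_trans (leq_mul (leqnn _) hK) (bin_sqr_le _ _).
rewrite sum_nat_const mulnC leq_mul2l; apply/orP; right.
exact: card_window.
Qed.

Lemma card_graphs_barely_large (n r K s : nat) :
  (K * r.+1) ^ 2 + s <= n ->
  #|[set G : {set {set 'I_n}} | is_graph G && (s <= #|barely_large r G|)]| * K ^ s
  <= 2 ^ n * 2 ^ #|vpairs n|.
Proof.
(* The rows are resampled on the complement of [S], whose size $n-s$ is large enough by [h]. *)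
move=> h; apply: card_graphs_many_rows => S cS.
have := @card_graphs_rows n S (~: S) (fun i G => i \in barely_large r G) K.
rewrite cS => /(_ _ _ _)/(leq_trans _); apply.
- rewrite leq_mul2r; apply/orP; right; apply: subset_leq_card.
  apply/fintype.subsetP => G; rewrite !inE => /andP[-> /fintype.subsetP h'].
  exact/forall_inP.
- by rewrite -setI_eq0 finset.setICr.
- move=> i j Y G iS jS ji sY; rewrite !inE neighbours_star_other //.
  apply/negP => /(fintype.subsetP sY); by rewrite inE jS.
- move=> i G iS; apply: card_barely_large_row.
  have := cardsC S; rewrite card_ord; lia.
Qed.

(* Switching at [T] changes the degree of [i \notin T] by
   [#|T| - 2 * #|neighbours G i :&: T|]. *)
Definition harmed (n l : nat) (T : {set 'I_n}) (G : {set {set 'I_n}}) : {set 'I_n} :=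
  [set i | (i \notin T) && (l.*2 + #|T|.*2 <= #|neighbours G i :&: T|.*2.*2)].

(** Being harmed means that the number $k$ of neighbours in [T] satisfies $2k-|T| \ge l$; by
    Chebyshev this has probability at most $|T|/l^2 \le 1/K$. *)
Lemma card_harmed_row (n l K : nat) (T : {set 'I_n}) i G :
  K * #|T| <= l ^ 2 -> 0 < l ->
  #|[set Y : {set 'I_n} | (Y \subset T)
      && (i \in harmed l T (symd G (star i Y)))]| * K <= 2 ^ #|T|.
Proof.
move=> hK l0; set N := neighbours G i.
pose P k := (l.*2 + #|T|.*2 <= k.*2.*2).
have : #|[set Y : {set 'I_n} | (Y \subset T) && P #|Y|]| * l ^ 2 <= #|T| * 2 ^ #|T|.
  apply: card_subsets_deviation => k; rewrite /P => h.
  by rewrite ler_sqr ?nnegrE; lia.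
rewrite -(card_subsets_shift (fun Y => P #|Y|) (finset.subsetIr N T)).
set X := #|_| => hX.
suff : X * K <= 2 ^ #|T|.
  apply: leq_trans; rewrite leq_mul2r; apply/orP; right; apply: subset_leq_card.
  apply/fintype.subsetP => Y; rewrite !inE => /and3P[sY _].
  rewrite sY /P /=; suff -> : symd (N :&: T) Y = neighbours (symd G (star i Y)) i :&: T by [].
  rewrite neighbours_star -/N; move: (N) => M; apply/setP => x; rewrite !inE.
  have := fintype.subsetP sY x.
  by case: (x \in T); case: (x \in Y); case: (x \in M) => //= H; have := H isT.
(* For empty [T] one cannot cancel $|T|$, but then [0 < l] forces the count [X] to be 0. *)
case: (posnP #|T|) => T0; last by rewrite -(leq_pmul2l T0); nia.
move: hX; rewrite T0; nia.
Qed.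

Lemma card_graphs_harmed (n l K s : nat) (T : {set 'I_n}) :
  K * #|T| <= l ^ 2 -> 0 < l ->
  #|[set G : {set {set 'I_n}} | is_graph G && (s <= #|harmed l T G|)]| * K ^ s
  <= 2 ^ n * 2 ^ #|vpairs n|.
Proof.
move=> h l0; apply: card_graphs_many_rows => S cS.
(* Harmed vertices lie outside [T], so a set [S] that meets [T] contributes no graph. *)
case: (boolP [disjoint S & T]) => dST; last first.
  rewrite (_ : [set _ | _] = finset.set0) ?cards0 //; apply/setP => G; rewrite !inE.
  apply/negbTE; apply: contra dST => /andP[_ /fintype.subsetP sS].
  apply/pred0P => x /=; apply/negbTE/negP => /andP[/sS]; rewrite inE => /andP[xT _].
  by rewrite (negbTE xT).
have := @card_graphs_rows n S T (fun i G => i \in harmed l T G) K dST.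
rewrite cS => /(_ _ _)/(leq_trans _); apply.
- rewrite leq_mul2r; apply/orP; right; apply: subset_leq_card.
  apply/fintype.subsetP => G; rewrite !inE => /andP[-> /fintype.subsetP h'].
  exact/forall_inP.
- move=> i j Y G iS jS ji sY; rewrite !inE neighbours_star_other //.
  apply/negP => /(fintype.subsetP sY) jT.
  by move/pred0P: dST => /(_ j) /=; rewrite jS jT.
- by move=> i G iS; apply: card_harmed_row.
Qed.

(** * Locally optimal switchings and their balance *)

Definition locally_optimal (n : nat) (G : {set {set 'I_n}}) (A : {set 'I_n}) : bool :=
  [forall i, n <= (#|neighbours (switch A G) i|.*2).+1].

Lemma sum_bool_row_column (n : nat) (a : rel 'I_n) (i : 'I_n) :
  (forall v w, a v w = a w v) -> ~~ a i i ->
  \sum_v \sum_w (a v w : nat)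
  = (\sum_w (a i w : nat)).*2 + \sum_(v | v != i) \sum_(w | w != i) (a v w : nat).
Proof.
move=> sym irr; rewrite (bigD1 i) //=.
have -> : \sum_(v | v != i) \sum_w (a v w : nat)
   = \sum_(v | v != i) (a i v : nat) + \sum_(v | v != i) \sum_(w | w != i) (a v w : nat).
  by rewrite -big_split /=; apply: eq_bigr => v _; rewrite (bigD1 i) //= sym.
have -> : \sum_(v | v != i) (a i v : nat) = \sum_v (a i v : nat).
  by rewrite [RHS](bigD1 i) //= (negbTE irr).
by rewrite addnA addnn.
Qed.

Lemma card_neighbours_sum (n : nat) (G : {set {set 'I_n}}) v :
  #|neighbours G v| = \sum_w ([set v; w] \in G : nat).
Proof.
rewrite -sum1_card big_mkcond /=; apply: eq_bigr => w _.
by rewrite inE; case: (_ \in _).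
Qed.

(* A switching with the largest number of edges is locally optimal. *)
Lemma exists_locally_optimal (n : nat) (G : {set {set 'I_n}}) :
  is_graph G -> exists A, locally_optimal G A.
Proof.
move=> gG.
pose e A := \sum_v \sum_w ([set v; w] \in switch A G : nat).
have [A _ maxA] := @arg_maxnP {set 'I_n} finset.set0 predT e isT.
exists A; apply/forallP => i; pose B := symd A [set i].
have irr C : ~~ ([set i; i] \in switch C G).
  by have := @neighbours_irr n (switch C G) i; rewrite is_graph_switch inE => /(_ gG).
have sym C v w : ([set v; w] \in switch C G) = ([set w; v] \in switch C G).
  by rewrite finset.setUC.
have /= := maxA B isT.
rewrite /e !(@sum_bool_row_column _ _ i) //.
(* Flipping [i] changes only pairs containing [i], so comparing edge counts amounts to comparing the
   two degrees of [i]. *)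
have -> : \sum_(v | v != i) \sum_(w | w != i) ([set v; w] \in switch B G : nat)
  = \sum_(v | v != i) \sum_(w | w != i) ([set v; w] \in switch A G : nat).
  apply: eq_bigr => v vi; apply: eq_bigr => w wi; rewrite !inE !in_cut !inE.
  by rewrite (negbTE vi) (negbTE wi) !addbF.
rewrite leq_add2r leq_double -!card_neighbours_sum => h.
(* Flipping [i] complements its neighbourhood among the other vertices: degree $x$ becomes $n-1-x$,
   and maximality gives $x \ge n-1-x$. *)
have : #|neighbours (switch A G) i| + #|neighbours (switch B G) i| = n.-1.
  have -> : neighbours (switch B G) i = [set~ i] :\: neighbours (switch A G) i.
    apply/setP => w; rewrite !inE !in_cut !inE eqxx.
    case: (eqVneq w i) => [->|wi].
      have := neighbours_irr i gG; rewrite inE => /negbTE ->.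
      by rewrite !addbb andbF.
    rewrite !addbF !andbT.
    by case: (i \in A); case: (w \in A); case: (_ \in _).
  have sN : neighbours (switch A G) i \subset [set~ i].
    apply/fintype.subsetP => w; rewrite !inE; apply: contraTneq => ->.
    by have := irr A; rewrite inE.
  by rewrite cardsD (finset.setIidPr sN) subnKC ?subset_leq_card // cardsC1 card_ord.
move: h (ltn_ord i); move: #|_| #|_| => x y; lia.
Qed.

Definition nearly_balanced (n t a : nat) : bool := (a <= n./2 + t) && (n./2 <= a + t).

(** If [A0] is locally optimal for [G], then [symd A0 B] is locally optimal for [switch B G]. For
    uniform [B] this set is uniform, so Chebyshev bounds its imbalance. *)
Lemma card_graphs_unbalanced (n t K : nat) :
  K * n <= (t.*2.+1) ^ 2 ->
  #|[set G : {set {set 'I_n}} | is_graph G &&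
      ~~ [exists A, locally_optimal G A && nearly_balanced n t #|A|]]| * K
  <= 2 ^ #|vpairs n|.
Proof.
move=> hK; rewrite -card_graphs.
apply: (@card_average _ _ (@switch n) [set: {set 'I_n}]).
- by move=> A _; exact: switchK.
- by move=> G A _; rewrite is_graph_switch.
- move=> G gG; have [A0 optA0] := exists_locally_optimal gG.
  have hdev := @card_subsets_deviation 'I_n [set: 'I_n]
    (fun k => ~~ nearly_balanced n t k) t.*2.+1.
  have {}hdev := hdev _; rewrite cardsT card_ord in hdev.
  have := card_subsets_shift (fun B => ~~ nearly_balanced n t #|B|) (finset.subsetT A0).
  set X := #|_|; set Y := #|_| => E.
  have {}hdev : Y * t.*2.+1 ^ 2 <= n * 2 ^ n.
    apply: hdev => k; rewrite /nearly_balanced => h.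
    have h2 := odd_double_half n.
    (* The sum of the two truncated differences is $|n-2k|$; the odd bound $2t+1$ survives the
       rounding in [n./2]. *)
    have h1 : (t.*2.+1 <= (n - k.*2) + (k.*2 - n))%N by case: (odd n) h2; lia.
    nia.
  rewrite cardsT card_sets_ord.
  have hX : X * K <= 2 ^ n.
    rewrite E; case: (posnP n) => n0; last by rewrite -(leq_pmul2l n0); nia.
    have : Y * t.*2.+1 ^ 2 <= 0 by rewrite (leq_trans hdev) // n0.
    by nia.
  apply: leq_trans hX; rewrite leq_mul2r; apply/orP; right.
  apply: subset_leq_card; apply/fintype.subsetP => B; rewrite !inE /= finset.subsetT.
  apply: contra => hB; apply/existsP; exists (symd A0 B); rewrite hB andbT.
  apply/forallP => i; move/forallP: optA0 => /(_ i).
  suff -> : neighbours (switch (symd A0 B) (switch B G)) i = neighbours (switch A0 G) i by [].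
  apply/setP => w; rewrite !inE !in_cut !inE.
  by case: (_ \in G); case: (i \in A0); case: (i \in B); case: (w \in A0); case: (w \in B).
- by rewrite cardsT card_sets_ord expn_gt0.
Qed.

(** * From a nearly balanced optimal set to a bisection with few unfriendly vertices *)

Lemma exists_balancing (n t : nat) (A : {set 'I_n}) :
  nearly_balanced n t #|A| ->
  exists2 T : {set 'I_n}, #|T| <= t & #|symd A T| = n./2.
Proof.
move=> /andP[h1 h2]; case: (leqP n./2 #|A|) => h.
  have [T sT cT] := @exists_subset_card _ A (#|A| - n./2) (leq_subr _ _).
  exists T; first by lia.
  have -> : symd A T = A :\: T.
    apply/setP => x; rewrite !inE; have := fintype.subsetP sT x.
    by case: (x \in T); case: (x \in A) => //= H; have := H isT.
  by rewrite cardsD (finset.setIidPr sT); lia.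
have cA : n./2 - #|A| <= #|~: A|.
  by have := cardsC A; rewrite card_ord; lia.
have [T sT cT] := exists_subset_card cA.
exists T; first by lia.
have -> : symd A T = A :|: T.
  apply/setP => x; rewrite !inE; have := fintype.subsetP sT x; rewrite inE.
  by case: (x \in T); case: (x \in A) => //= H; have := H isT.
have := cardsUI A T; have -> : A :&: T = finset.set0.
  apply/setP => x; rewrite !inE; have := fintype.subsetP sT x; rewrite inE.
  by case: (x \in T); case: (x \in A) => //= H; have := H isT.
rewrite cards0; lia.
Qed.

Lemma bisection_half (n : nat) (A : {set 'I_n}) : #|A| = n./2 -> bisection A.
Proof.
by move=> cA; have := cardsC A; rewrite card_ord /bisection cA; lia.
Qed.

(** With [O] the part of [v], the switched degree is $|N \cap O| + |O^c| - |N \cap O^c|$, so it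
    exceeds $|O^c|$ exactly when [v] is friendly. A bisection has $2|O^c| \le n+1$. *)
Lemma friendly_switch (n : nat) (G : {set {set 'I_n}}) (A : {set 'I_n}) v :
  is_graph G -> bisection A ->
  n.+2 <= #|neighbours (switch A G) v|.*2 -> friendly G A v.
Proof.
move=> gG bA; rewrite /friendly; set O := own_part A v; set N := neighbours G v.
have hO : (#|~: O|.*2 <= n.+1)%N.
  have := cardsC A; rewrite card_ord; move: bA; rewrite /bisection /O /own_part.
  by case: ifP => _; rewrite ?finset.setCK; lia.
have -> : neighbours (switch A G) v = (N :&: O) :|: (~: O :\: N).
  have E w : (w \in O) = ~~ ((v \in A) (+) (w \in A)).
    by rewrite /O /own_part; case: (v \in A); rewrite ?inE; case: (w \in A).
  rewrite neighbours_switch -/N; move: (N) => M; apply/setP => w; rewrite !inE E.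
  by case: (w \in M); case: ((v \in A) (+) (w \in A)).
have -> : #|(N :&: O) :|: (~: O :\: N)| = #|N :&: O| + #|~: O :\: N|.
  rewrite cardsU (_ : (N :&: O) :&: _ = finset.set0) ?cards0 ?subn0 //.
  move: (N) (O) => M P; apply/setP => w; rewrite !inE.
  by case: (w \in M); case: (w \in P).
have := cardsID N (~: O); rewrite finset.setIC; lia.
Qed.

Lemma card_symd_inter (T : finType) (A B : {set T}) :
  #|symd A B| + (#|A :&: B|).*2 = #|A| + #|B|.
Proof.
rewrite -(cardsID B A) -(cardsID A B) (finset.setIC B A).
have -> : symd A B = (A :\: B) :|: (B :\: A).
  by apply/setP => x; rewrite !inE; case: (x \in A); case: (x \in B).
rewrite cardsU (_ : _ :&: _ = finset.set0); last first.
  by apply/setP => x; rewrite !inE; case: (x \in A); case: (x \in B).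
rewrite cards0; lia.
Qed.

Lemma exists_mostly_friendly (n l s t : nat) (G : {set {set 'I_n}}) :
  is_graph G ->
  (forall A, #|barely_large l.*2.+1 (switch A G)| < s) ->
  (forall A (T : {set 'I_n}), #|T| <= t -> #|harmed l T (switch A G)| < s) ->
  [exists A, locally_optimal G A && nearly_balanced n t #|A|] ->
  exists2 A, bisection A & #|~: friendly_vertices G A| <= s.*2 + t.
Proof.
move=> gG hb hh /existsP[A /andP[/forallP optA /exists_balancing[T tT cT]]].
exists (symd A T); first exact: bisection_half.
(* Let $x$ be the degree of [v] after switching at [A]. Outside the first set, optimality gives $2x
   \ge n+2l+1$; a vertex outside the other two loses less than $l$ when [T] is flipped, so twice its
   new degree is at least $n+2$. *)
have sub : ~: friendly_vertices G (symd A T) \subset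
   (barely_large l.*2.+1 (switch A G) :|: harmed l T (switch A G)) :|: T.
  apply/fintype.subsetP => v; rewrite !finset.in_setU !inE; apply: contraR.
  rewrite !negb_or => /andP[/andP[nb nh] vT].
  apply: friendly_switch => //; first exact: bisection_half.
  have -> : neighbours (switch (symd A T) G) v = symd (neighbours (switch A G) v) T.
    apply/setP => w; rewrite !inE !in_cut !inE (negbTE vT).
    by case: (_ \in G); case: (v \in A); case: (w \in A); case: (w \in T).
  have := card_symd_inter (neighbours (switch A G) v) T.
  have := optA v; move: nb nh; rewrite vT /=; lia.
apply: leq_trans (subset_leq_card sub) _.
have := (leq_card_setU (barely_large l.*2.+1 (switch A G) :|: harmed l T (switch A G)) T).1.
have := (leq_card_setU (barely_large l.*2.+1 (switch A G)) (harmed l T (switch A G))).1.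
have := hb A; have := hh A T tT; lia.
Qed.

(** * Union bounds over all switchings, and the choice of parameters *)

Lemma card_graphs_some_barely_large (n r K s : nat) :
  (K * r.+1) ^ 2 + s <= n ->
  #|[set G : {set {set 'I_n}} | is_graph G &&
      [exists A, s <= #|barely_large r (switch A G)|]]| * K ^ s
  <= (2 ^ n) ^ 2 * 2 ^ #|vpairs n|.
Proof.
move=> h; have := @card_union_bound _ {set 'I_n}
  (fun A G => is_graph G && (s <= #|barely_large r (switch A G)|))
  (K ^ s) (2 ^ n * 2 ^ #|vpairs n|).
rewrite card_sets_ord mulnA mulnn => /(_ _)/(leq_trans _); apply; last first.
  move=> A; rewrite (card_graphs_switch A (fun G => s <= #|barely_large r G|)).
  exact: card_graphs_barely_large.
rewrite leq_mul2r; apply/orP; right; apply: subset_leq_card.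
apply/fintype.subsetP => G; rewrite !inE => /andP[gG /existsP[A hA]].
by apply/existsP; exists A; rewrite gG.
Qed.

(** The three factors [2 ^ n] pay for [A], for [T] and for the set of [s] harmed vertices. *)
Lemma card_graphs_some_harmed (n l K s t : nat) :
  K * t <= l ^ 2 -> 0 < l ->
  #|[set G : {set {set 'I_n}} | is_graph G &&
      [exists A, [exists T : {set 'I_n}, (#|T| <= t)
         && (s <= #|harmed l T (switch A G)|)]]]| * K ^ s
  <= (2 ^ n) ^ 3 * 2 ^ #|vpairs n|.
Proof.
move=> h l0; have := @card_union_bound _ ({set 'I_n} * {set 'I_n})%type
  (fun AT G => [&& #|AT.2| <= t, is_graph G
     & s <= #|harmed l AT.2 (switch AT.1 G)|])
  (K ^ s) (2 ^ n * 2 ^ #|vpairs n|).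
rewrite card_prod card_sets_ord mulnA mulnn -expnSr.
move=> /(_ _)/(leq_trans _); apply; last first.
  move=> [A T] /=; case: (leqP #|T| t) => hT /=; last first.
    by rewrite (_ : [set _ | _] = finset.set0) ?cards0 //; apply/setP => G; rewrite !inE.
  rewrite (card_graphs_switch A (fun G => s <= #|harmed l T G|)).
  by apply: card_graphs_harmed => //; apply: leq_trans h; rewrite leq_mul2l hT orbT.
rewrite leq_mul2r; apply/orP; right; apply: subset_leq_card.
apply/fintype.subsetP => G; rewrite !inE => /andP[gG /existsP[A /existsP[T /andP[hT hA]]]].
by apply/existsP; exists (A, T); rewrite gG hT.
Qed.

Lemma exists_sqrtn m : exists q, q ^ 2 <= m < q.+1 ^ 2.
Proof.
elim: m => [|m [q /andP[h1 h2]]]; first by exists 0.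
case: (ltnP m.+1 (q.+1 ^ 2)) => h; first by exists q; rewrite h andbT ltnW.
by exists q.+1; rewrite h; nia.
Qed.

(** Each row gains a factor $16^{4d}$, so $s \ge n/(4d)$ rows gain $16^n$. The scales are $s$ and
    $t$ linear in $n$ and $l$ of order $\sqrt n$, with $t$ small enough that $16^{4d} t \le l^2$. *)
Lemma choose_parameters (d K : nat) : 0 < d -> 0 < K ->
  exists n0, forall n, n0 <= n -> exists s l t,
  [/\ (16 ^ (4 * d) * l.*2.+2) ^ 2 + s <= n, 16 ^ (4 * d) * t <= l ^ 2 /\ 0 < l,
      3 * K * n <= t.*2.+1 ^ 2, n <= 4 * d * s /\ d * (s.*2 + t) <= n
    & 3 * K <= 2 ^ n].
Proof.
move=> d0 K0.
have := @ltn_expl 16 (4 * d) isT; move: (16 ^ (4 * d)) => kap kd.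
(* With $q^2 \le m \le n/c$, this $c$ makes $2(2q \cdot kap)^2 = c q^2 \le n$, which leaves half of
   $n$ for [s]. *)
have [c c0 cE] : exists2 c, 0 < c & c = 8 * kap ^ 2.
  by exists (8 * kap ^ 2); rewrite // muln_gt0 expn_gt0; lia.
(* With $t \le n/L$, this $L$ gives $18 \cdot kap \cdot t \le m < (q+1)^2 \le 9(q-1)^2$, hence $kap
   \cdot t \le l^2$ for $l = q-1$. *)
have [L L0 LE] : exists2 L, 0 < L & L = 18 * kap * c.
  by exists (18 * kap * c); rewrite // muln_gt0 c0 muln_gt0; lia.
have Ld : 8 * d <= L by rewrite LE {LE cE L0}; nia.
exists (4 * c + 16 * d + 3 * K * L * L + 3 * K) => n hn.
have n1 : 4 * c <= n by lia.
have n2 : 16 * d <= n by lia.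
have n3 : 3 * K * L * L <= n by lia.
have n4 : 3 * K <= n by lia.
clear hn.
have [m [m1 m2 m4]] : exists m, [/\ c * m <= n, n < c * m.+1 & 4 <= m].
  exists (n %/ c); split; first by rewrite mulnC leq_trunc_div.
    by rewrite mulnC ltn_ceil.
  by rewrite leq_divRL.
have [t [t1 t2 t3]] : exists t, [/\ L * t <= n, n < L * t.+1 & 3 * K * L <= t].
  exists (n %/ L); split; first by rewrite mulnC leq_trunc_div.
    by rewrite mulnC ltn_ceil.
  by rewrite leq_divRL.
have [s [s1 s2]] : exists s, 4 * d * s <= n /\ n < 4 * d * s.+1.
  exists (n %/ (4 * d)); split; first by rewrite mulnC leq_trunc_div.
  by rewrite mulnC ltn_ceil // muln_gt0.
have [q /andP[q1 q2]] := exists_sqrtn m.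
(* This makes $l = q-1$ positive and gives $q+1 \le 3(q-1)$. *)
have q3 : 2 <= q.
  rewrite leqNgt; apply/negP => hq; move: q2; rewrite ltnNge => /negP; apply.
  by apply: leq_trans m4; rewrite -[4]/(2 ^ 2) leq_sqr.
(* The successor rounds $n/(4d)$ up, as $n \le 4ds$ requires; the choice $l = q-1$ turns $2l+2$ into
   $2q$. *)
exists s.+1, q.-1, t; split.
- have -> : q.-1.*2.+2 = 2 * q by lia.
  have e : (kap * (2 * q)) ^ 2 * 2 = c * q ^ 2 by rewrite cE; ring.
  have e1 : (kap * (2 * q)) ^ 2 * 2 <= n.
    by rewrite e; apply: leq_trans m1; rewrite leq_mul2l q1 orbT.
  have : 4 * s <= n by apply: leq_trans s1; rewrite leq_mul2r; apply/orP; right; lia.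
  move: e1; move: (_ ^ 2) => x; lia.
- split; last by lia.
  have h : 18 * kap * t <= m.
    rewrite -ltnS -(ltn_pmul2l c0); apply: leq_ltn_trans m2.
    by apply: leq_trans t1; rewrite LE mulnA (mulnC c).
  have h' : q.+1 ^ 2 <= 9 * q.-1 ^ 2.
    by rewrite -[9]/(3 ^ 2) -expnMn leq_sqr; lia.
  move: h h' q2; rewrite -mulnA; move: (kap * t) (q.+1 ^ 2) (q.-1 ^ 2) => x y z; lia.
- apply: leq_trans (_ : 3 * K * (L * t.+1) <= _).
    by rewrite leq_mul2l ltnW ?orbT.
  rewrite mulnA; apply: leq_trans (_ : t * t.+1 <= _); first by rewrite leq_mul2r t3 orbT.
  by rewrite -mulnn leq_mul //; lia.
- split; first exact: ltnW.
  have : 8 * d * t <= n by apply: leq_trans t1; rewrite leq_mul2r Ld orbT.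
  rewrite -mul2n mulnDr mulnCA mulnS.
  move: s1 n2; rewrite -!mulnA; move: (d * s) (d * t) => x y; lia.
- by apply: leq_trans n4 (ltnW (ltn_expl n (isT : 1 < 2))).
Qed.

Lemma few_graphs_without_bisection (d K : nat) : 0 < d -> 0 < K ->
  exists n0, forall n, n0 <= n ->
  #|[set G : {set {set 'I_n}} | is_graph G &&
      ~~ [exists A, bisection A && (d * #|~: friendly_vertices G A| <= n)]]| * K
  <= 2 ^ #|vpairs n|.
Proof.
move=> d0 K0; have [n0 H] := choose_parameters d0 K0; exists n0 => n /H.
move=> [s [l [t [h1 [h2 l0] h3 [h4 h5] h6]]]] {n0 H}.
set N := 2 ^ #|vpairs n|.
(* The gain $16^n$ beats the at most $8^n$ choices with $2^n \ge 3K$ to spare, so each of the three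
   failures has frequency at most $1/(3K)$. *)
have big : (2 ^ n) ^ 4 <= (16 ^ (4 * d)) ^ s.
  by rewrite -!expnM (_ : 16 = 2 ^ 4) // -expnM leq_exp2l //; lia.
have b1 := @card_graphs_some_barely_large n l.*2.+1 _ s h1.
have b2 := @card_graphs_some_harmed n l _ s t h2 l0.
have b3 := card_graphs_unbalanced h3.
rewrite -/N in b1 b2 b3.
set B := #|_|; move: b1 b2 b3.
set B1 := #|_|; set B2 := #|_|; set B3 := #|_| => b1 b2 b3.
have sub : B <= B1 + B2 + B3.
  rewrite /B1 /B2 /B3.
  set S1 := [set _ | _]; set S2 := [set _ | _]; set S3 := [set _ | _].
  apply: leq_trans (_ : #|S1 :|: S2 :|: S3| <= _); last first.
    apply: leq_trans (leq_card_setU _ _).1 _; rewrite leq_add2r.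
    exact: (leq_card_setU _ _).1.
  apply: subset_leq_card; apply/fintype.subsetP => G; rewrite !inE => /andP[gG].
  rewrite gG /=; apply: contraR; rewrite !negb_or => /andP[/andP[n1 n2]].
  rewrite negbK => /(exists_mostly_friendly gG) H.
  have [|A T tT|A bA hA] := H l s _ _.
  - by move=> A; rewrite ltnNge; apply: contra n1 => h; apply/existsP; exists A.
  - rewrite ltnNge; apply: contra n2 => h; apply/existsP; exists A.
    by apply/existsP; exists T; rewrite tT.
  - apply/existsP; exists A; rewrite bA /= (leq_trans _ h5) //.
    by rewrite leq_mul2l hA orbT.
have p0 : 0 < 2 ^ n by rewrite expn_gt0.
have c1 : B1 * 2 ^ n <= N.
  rewrite -(@leq_pmul2l ((2 ^ n) ^ 3)) ?expn_gt0 //.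
  apply: leq_trans (_ : B1 * (2 ^ n) ^ 4 <= _); first by rewrite mulnCA -expnSr.
  apply: leq_trans (_ : B1 * (16 ^ (4 * d)) ^ s <= _); first by rewrite leq_mul2l big orbT.
  by apply: leq_trans b1 _; rewrite leq_mul2r leq_pexp2l ?orbT.
have c2 : B2 * 2 ^ n <= N.
  rewrite -(@leq_pmul2l ((2 ^ n) ^ 3)) ?expn_gt0 //.
  apply: leq_trans (_ : B2 * (2 ^ n) ^ 4 <= _); first by rewrite mulnCA -expnSr.
  by apply: leq_trans b2; rewrite leq_mul2l big orbT.
have {}c1 : B1 * (3 * K) <= N by apply: leq_trans c1; rewrite leq_mul2l h6 orbT.
have {}c2 : B2 * (3 * K) <= N by apply: leq_trans c2; rewrite leq_mul2l h6 orbT.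
have : B * (3 * K) <= 3 * N.
  apply: leq_trans (leq_mul sub (leqnn _)) _; rewrite !mulnDl; lia.
by rewrite mulnCA leq_pmul2l.
Qed.

(** * From counting graphs to probabilities and the limit *)

Local Open Scope ring_scope.

(** At $p = 1/2$ an edge and a non-edge weigh the same, so the law is uniform on graphs. *)
Lemma Gnp_prob_half (R : realType) (n : nat) (E : pred {set {set 'I_n}}) :
  Gnp_prob (2^-1 : R) E
  = #|[set G : {set {set 'I_n}} | is_graph G && E G]|%:R / 2 ^+ #|vpairs n|.
Proof.
rewrite /Gnp_prob (eq_bigr (fun=> (2 ^+ #|vpairs n|)^-1)); last first.
  move=> G _; rewrite /Gnp_mass (eq_bigr (fun=> 2^-1)) ?prodr_const ?exprVn //.
  by move=> e _; case: ifP => // _; field.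
rewrite sumr_const -[LHS]mulr_natl; congr (_%:R * _).
by apply: eq_card => G; rewrite inE.
Qed.

Lemma Gnp_prob_half_near_one (R : realType) (n K : nat) (E : pred {set {set 'I_n}}) :
  (0 < K)%N ->
  (#|[set G : {set {set 'I_n}} | is_graph G && ~~ E G]| * K <= 2 ^ #|vpairs n|)%N ->
  `|1 - Gnp_prob (2^-1 : R) E| <= K%:R^-1.
Proof.
move=> K0 bad; have N0 : 0 < 2 ^+ #|vpairs n| :> R by rewrite exprn_gt0.
have tot : (#|[set G | is_graph G && E G]| + #|[set G | is_graph G && ~~ E G]|
    = 2 ^ #|vpairs n|)%N.
  rewrite -card_graphs -(cardsID [set G | E G] [set G | is_graph G]).
  by congr (_ + _)%N; apply: eq_card => G; rewrite !inE // andbC.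
rewrite Gnp_prob_half.
have -> : 1 - #|[set G | is_graph G && E G]|%:R / 2 ^+ #|vpairs n|
  = #|[set G | is_graph G && ~~ E G]|%:R / 2 ^+ #|vpairs n| :> R.
  rewrite -[X in X - _](@divff _ (2 ^+ #|vpairs n| : R)) ?gt_eqF // -mulrBl.
  congr (_ / _); rewrite -natrX -tot natrD addrC addKr //.
rewrite ger0_norm; last by rewrite divr_ge0 // ltW.
rewrite ler_pdivrMr //.
by rewrite ler_pdivlMl ?ltr0n // -natrM -natrX ler_nat mulnC.
Qed.

Local Open Scope classical_set_scope.
Local Open Scope ring_scope.

Theorem theorem1p1 (R : realType) (delta : R) (hdelta : 0 < delta) :
  Gnp_prob (n := n) (2^-1 : R) (fun G : {set {set 'I_n}} =>
    [exists A : {set 'I_n}, bisection A &&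
      ((1 - delta) * n%:R <= #|friendly_vertices G A|%:R)])
  @[n --> \oo] --> (1 : R).
Proof.
apply/cvgrPdist_le => eps eps0.
have recip (x : R) : 0 < x -> exists2 d : nat, (0 < d)%N & d%:R^-1 <= x.
  move=> x0; exists (Num.truncn x^-1).+1 => //.
  by rewrite invf_ple ?posrE ?ltr0n // ltW // truncnS_gt.
(* At most $n/d \le \delta n$ vertices will be unfriendly, outside an event of probability at most
   $1/K \le \varepsilon$. *)
have [d d0 hd] := recip _ hdelta; have [K K0 hK] := recip _ eps0.
have [n0 H] := few_graphs_without_bisection d0 K0.
exists n0 => // n /= /H {}H.
apply: le_trans hK; apply: Gnp_prob_half_near_one => //.
apply: leq_trans H; rewrite leq_mul2r; apply/orP; right; apply: subset_leq_card.
apply/fintype.subsetP => G; rewrite !inE => /andP[-> /=]; apply: contra.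
move=> /existsP[A /andP[bA hA]]; apply/existsP; exists A; rewrite bA /=.
have split_n : #|friendly_vertices G A|%:R + #|~: friendly_vertices G A|%:R = n%:R :> R.
  by rewrite -natrD cardsC card_ord.
have few : #|~: friendly_vertices G A|%:R <= delta * n%:R :> R.
  apply: le_trans (_ : d%:R^-1 * n%:R <= _); last by rewrite ler_wpM2r.
  by rewrite ler_pdivlMl ?ltr0n // -natrM ler_nat.
lra.
Qed.
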